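(* Let $q\ge1$, let $\{a_n\}_{n\ge1}$, $\{b_n\}_{n\ge1}$ be real $q$-periodic sequences with $a_n>0$, and let $J_0$ be the Jacobi operator with coefficients $a_n,b_n$, with spectral bands $[c_k,d_k]$ and quasimomentum $k(E)$. Suppose $\{E_j\}_{j=1}^N\subset\bigcup_k(c_k,d_k)$ is such that the quasimomenta $k(E_1),\dots,k(E_N)$ are pairwise different, and suppose $k(E_i)+k(E_j)\ne\pi$ for any $i,j\in\{1,\dots,N\}$ (including $i=j$). Let $a'_n=0$ for all $n$. Then for any given $\{\theta_j\}_{j=1}^N\subset[0,\pi]$ there exists a real sequence $(b'_n)$ with $$b'_n=\frac{O(1)}{1+n}\quad\text{as }n\to\infty$$ such that for every $j\in\{1,\dots,N\}$ the equation $Ju=E_ju$, where $(Ju)(n)=a_{n+1}u(n+1)+a_nu(n-1)+(b_{n+1}+b'_{n+1})u(n)$, has a (non-trivial) $\ell^2(\mathbb{Z}_{\ge0})$ solution with boundary condition $$\frac{u(1)}{u(0)}=\tan\theta_j.$$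
   Context: The unperturbed operator is $(J_0u)(n)=a_{n+1}u(n+1)+a_nu(n-1)+b_{n+1}u(n)$. A solution of $Ju=Eu$ on $\mathbb{Z}_{\ge0}$ is a sequence $(u(n))_{n\ge0}$ satisfying $(Ju)(n)=Eu(n)$ for all $n\ge1$, so that it is determined by $(u(0),u(1))$. We have $\sigma_{\rm ac}(J_0)=\sigma_{\rm ess}(J_0)=\bigcup_k[c_k,d_k]$. For $E\in(c_k,d_k)$ there is a Floquet solution $\varphi(n)=p(n)e^{i\frac{k(E)}{q}n}$ of $J_0\varphi=E\varphi$, where $p$ is $q$-periodic and $k(E)\in(0,\pi)$ is the quasimomentum, so $\varphi(n+q)=e^{ik(E)}\varphi(n)$. The open intervals $(c_k,d_k)$ are the connected components of the set of real $E$ for which the discriminant (trace of the transfer matrix over one period, equal to $2\cos k(E)$ there) has absolute value less than $2$. The boundary condition $u(1)/u(0)=\tan\theta_j$ with $\theta_j=\pi/2$ means $u(0)=0$. *)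

(* Defs.v *)
From HB Require Import structures.
From mathcomp Require Import all_boot all_order all_algebra.
From mathcomp Require Import all_classical all_reals all_analysis.
From mathcomp Require Import complex.
Import Order.TTheory GRing.Theory Num.Theory.
Import numFieldNormedType.Exports.

Set Implicit Arguments.
Unset Strict Implicit.
Unset Printing Implicit Defensive.

Local Open Scope classical_set_scope.
Local Open Scope ring_scope.
Local Open Scope complex_scope.

(* Only meant for n >= 1 (n.-1 is truncated at 0), so a 0 and b 0 never occur. *)
Definition jacobi (F : pzRingType) (a b u : nat -> F) (n : nat) : F :=
  a n.+1 * u n.+1 + a n * u n.-1 + b n.+1 * u n.

(* The equation is only required for n >= 1, so that u 0 and u 1 are free and
   determine u. *)
Definition jacobi_solution (F : pzRingType) (a b : nat -> F) (E : F)
    (u : nat -> F) : Prop :=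
  forall n, (1 <= n)%N -> jacobi a b u n = E * u n.

Definition periodic_from1 (T : Type) (q : nat) (c : nat -> T) : Prop :=
  forall n, (1 <= n)%N -> c (n + q)%N = c n.

(* Maps (u n, u n.-1) to (u n.+1, u n), as column vectors. *)
Definition transfer_step (R : realType) (a b : nat -> R) (E : R) (n : nat) :
    'M[R]_2 :=
  \matrix_(i, j)
    if i == 0 then
      if j == 0 then (E - b n.+1) / a n.+1 else - (a n / a n.+1)
    else (j == 0)%:R.

(* The ordered product T_q * ... * T_1, mapping (u 1, u 0) to (u q.+1, u q). *)
Definition monodromy (R : realType) (q : nat) (a b : nat -> R) (E : R) :
    'M[R]_2 :=
  \prod_(n <- rev (iota 1 q)) transfer_step a b E n.

Definition discriminant (R : realType) (q : nat) (a b : nat -> R) (E : R) : R :=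
  \tr (monodromy q a b E).

(* The open bands ]c_k, d_k[. *)
Definition open_bands (R : realType) (q : nat) (a b : nat -> R) :
    set (set R) :=
  let D := [set E : R | `|discriminant q a b E| < 2] in
  [set connected_component D E | E in D].

Definition expi (R : realType) (t : R) : R[i] := cos t +i* sin t.

(* [p n * e^(i k n / q)], with p q-periodic, is a non-trivial solution of the
   unperturbed equation. *)
Definition is_quasimomentum (R : realType) (q : nat) (a b : nat -> R)
    (E k : R) : Prop :=
  0 < k < pi /\
  exists p : nat -> R[i],
    [/\ forall n, p (n + q)%N = p n,
        exists n, p n != 0
      & jacobi_solution (fun n => (a n)%:C) (fun n => (b n)%:C) E%:C
          (fun n => p n * expi (k / q%:R * n%:R))].

(* For E in an open band there is exactly one such k; elsewhere there is none
   and the value is 0. *)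
Definition quasimomentum (R : realType) (q : nat) (a b : nat -> R) (E : R) : R :=
  xget 0 [set k | is_quasimomentum q a b E k].

Definition square_summable (R : realType) (u : nat -> R) : Prop :=
  cvgn (series (fun n => `|u n| ^+ 2)).

(* u 1 / u 0 = tan theta; in MathComp both tan (pi / 2) and division by 0 are
   0, so the convention at pi / 2 and u 0 != 0 are made explicit. *)
Definition boundary_condition (R : realType) (theta : R) (u : nat -> R) : Prop :=
  if theta == pi / 2 then u 0%N = 0
  else u 0%N != 0 /\ u 1%N / u 0%N = tan theta.

(* Main.v *)
(* The potential is perturbed only once per period, at the indices q m + 2.
   With v_m = (u (q m + 1), u (q m)), an elliptic coordinate zeta (linear in v)
   turns the monodromy at E_j into multiplication by exp (i k_j), and a
   perturbation of size beta_m into the kick Im += kappa_j beta_m Re.  For the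
   phase P_j = zeta_j / conj zeta_j,
     ln |zeta_j|^2 grows by at most kappa_j beta_m Im P_j + (kappa_j beta_m)^2.
   Choosing beta_m = - 4 / (m + 1) * sum_i Im P_i / kappa_i makes the first term
   - 4 / (m + 1) * (Im P_j)^2 plus cross terms.  All phases rotate by
   exp (2 i k_j) up to O(1 / m); since no 2 (k_i + k_j), nor 2 (k_i - k_j) with
   i <> j, is a multiple of 2 pi, summation by parts shows that everything but
   the mean value - 2 / (m + 1) has bounded sums.  Hence
   |zeta_j|^2 = O(m^-2) for all j simultaneously, whatever the initial data. *)
Require Import Defs.
From HB Require Import structures.
From mathcomp Require Import all_boot all_order all_algebra.
From mathcomp Require Import all_classical all_reals all_analysis.
From mathcomp Require Import complex ring lra.
Import Order.TTheory GRing.Theory Num.Theory.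
Import numFieldNormedType.Exports.

Set Implicit Arguments.
Unset Strict Implicit.
Unset Printing Implicit Defensive.

Local Open Scope classical_set_scope.
Local Open Scope ring_scope.
Local Open Scope complex_scope.

Local Notation Re := complex.Re.
Local Notation Im := complex.Im.

(** * Feedback-driven rotations *)

Lemma sum_sqr_harmonic_le (F : numFieldType) (n : nat) :
  \sum_(m < n) (m.+1%:R^-1 : F) ^+ 2 <= 2.
Proof.
(* The correction makes the bound telescope. At [n = 0] it reads 2, by the convention [0^-1 = 0], so
   the induction really starts at [n = 1]. *)
suff: \sum_(m < n) (m.+1%:R^-1 : F) ^+ 2 <= 2 - n%:R^-1.
  by move/le_trans; apply; rewrite gerBl invr_ge0.
elim: n => [|[|n] IHn]; first by rewrite big_ord0 invr0 subr0 ler0n.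
  by rewrite big_ord1 !invr1 expr1n [X in X - 1](_ : 2 = 1 + 1) // addrK.
rewrite big_ord_recr /= (le_trans (lerD IHn (lexx _)))// -addrA lerD2l.
have p1 : 0 < n.+1%:R :> F by [].
have p2 : 0 < n.+2%:R :> F by [].
rewrite -subr_ge0 (_ : _ - _ = (n.+1%:R * n.+2%:R ^+ 2)^-1).
  by rewrite invr_ge0 mulr_ge0// exprn_ge0.
have /eqP e : n.+2%:R == n.+1%:R + 1 :> F by rewrite -natr1.
rewrite {}e in p2 *; field.
by rewrite !gt_eqF.
Qed.

(* Summation by parts: [(1 - w) F m = (F m - F m.+1) + (F m.+1 - w F m)]. *)
Lemma oscillating_sum_le (C : numFieldType) (F : nat -> C) (w K : C) (n : nat) :
  (forall m, `|F m| <= 1) ->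
  (forall m, `|F m.+1 - w * F m| <= K * m.+1%:R^-1) ->
  `|1 - w| * `|\sum_(m < n) F m * m.+1%:R^-1| <= 2 + K * 2.
Proof.
move=> F1 Fw.
have K0 : 0 <= K.
  by have := le_trans (normr_ge0 _) (Fw 0%N); rewrite invr1 mulr1.
have h0 m : 0 <= m.+1%:R^-1 :> C by rewrite invr_ge0.
pose S n := \sum_(m < n) (F m - F m.+1) * m.+1%:R^-1.
(* With [h_m = 1 / (m + 1)], Abel summation gives [S k + F k h_k = F 0 h_0 - sum_(m < k) F (m + 1)
   (h_m - h_(m + 1))]. Since [|F| <= 1] and [h] decreases, the bound is [1 + (1 - h_k)]. *)
have hS k : `|S k + F k * k.+1%:R^-1| <= 2 - k.+1%:R^-1.
  elim: k => [|k IHk].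
    rewrite /S big_ord0 add0r invr1 mulr1 (le_trans (F1 0%N))//.
    by rewrite [X in X - 1](_ : 2 = 1 + 1) // addrK.
  rewrite /S big_ord_recr /= -/(S k).
  rewrite (_ : _ + _ = S k + F k / k.+1%:R
     - F k.+1 * (k.+1%:R^-1 - k.+2%:R^-1)); last by ring.
  rewrite (le_trans (ler_normB _ _))// (le_trans (lerD IHk (lexx _)))//.
  rewrite normrM.
  have hk : 0 <= k.+1%:R^-1 - k.+2%:R^-1 :> C.
    by rewrite subr_ge0 lef_pV2 ?posrE// ler_nat.
  rewrite (ger0_norm hk) (le_trans (lerD (lexx _) (ler_wpM2r hk (F1 _))))//.
  by rewrite mul1r addrA subrK.
have S2 : `|S n| <= 2.
  rewrite -[S n](addrK (F n * n.+1%:R^-1)) (le_trans (ler_normB _ _))//.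
  rewrite (le_trans (lerD (hS n) (lexx _)))// normrM (ger0_norm (h0 n)).
  by rewrite -addrA gerDl addrC subr_le0 ler_piMl.
rewrite -normrM (_ : (1 - w) * _ = S n +
    \sum_(m < n) (F m.+1 - w * F m) * m.+1%:R^-1); last first.
  rewrite mulr_sumr /S -big_split /=; apply: eq_bigr => m _; ring.
rewrite (le_trans (ler_normD _ _))// lerD//.
rewrite (le_trans (ler_norm_sum _ _ _))//.
rewrite (@le_trans _ _ (\sum_(m < n) K * (m.+1%:R^-1) ^+ 2))//.
  apply: ler_sum => m _; rewrite normrM (ger0_norm (h0 m)) expr2 mulrA.
  exact: ler_wpM2r.
by rewrite -mulr_sumr ler_wpM2l// sum_sqr_harmonic_le.
Qed.

Lemma oscillating_sum_bounded (R : realType) (F : nat -> R[i]) (w : R[i])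
    (K : R) :
  w != 1 -> (forall m, `|F m| <= 1) ->
  (forall m, `|F m.+1 - w * F m| <= (K * m.+1%:R^-1)%:C) ->
  exists B : R, forall n, `|\sum_(m < n) Re (F m) * m.+1%:R^-1| <= B.
Proof.
move=> w1 F1 Fw.
have cV m : (m.+1%:R^-1)%:C = m.+1%:R^-1 :> R[i] by rewrite fmorphV rmorph_nat.
have w1' : 0 < `|1 - w| by rewrite normr_gt0 subr_eq0 eq_sym.
exists (Re ((2 + K%:C * 2) / `|1 - w|)) => n.
have Fw' m : `|F m.+1 - w * F m| <= K%:C * m.+1%:R^-1.
  by rewrite -cV -rmorphM.
have := oscillating_sum_le n F1 Fw'.
rewrite mulrC -ler_pdivlMr// => /(le_trans (normc_ge_Re _)).
rewrite lecE => /andP[_ /=]; congr (`|_| <= _).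
rewrite (big_morph (@complex.Re R) (op1 := +%R) (id1 := 0))
  => [|[? ?] [? ?]|] //.
apply: eq_bigr => m _.
by rewrite -cV; case: (F m) => x y /=; rewrite mulr0 subr0.
Qed.

(** * Kicks, phases and the feedback rule *)

Definition sqnorm (R : realType) (z : R[i]) : R := Re z ^+ 2 + Im z ^+ 2.

Definition kick (R : realType) (t : R) (z : R[i]) : R[i] :=
  Re z +i* (Im z + t * Re z).

(** For [z != 0] this is [e^(2 i arg z)]: the doubled Prüfer angle, with no choice of argument
    involved. *)
Definition phase (R : realType) (z : R[i]) : R[i] := z / z^*.

Lemma sqnorm_gt0 (R : realType) (z : R[i]) : z != 0 -> 0 < sqnorm z.
Proof.
case: z => x y; rewrite eq_complex /= negb_and /sqnorm /=.
by case/orP => h; [apply: ltr_pwDl | apply: ltr_wpDl];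
   rewrite ?sqr_ge0 // exprn_even_gt0.
Qed.

Lemma sqnormM (R : realType) (y z : R[i]) :
  sqnorm (y * z) = sqnorm y * sqnorm z.
Proof. by case: y z => a b [c d]; rewrite /sqnorm /=; ring. Qed.

Lemma kick_neq0 (R : realType) (t : R) (z : R[i]) : z != 0 -> kick t z != 0.
Proof.
apply: contra; rewrite !eq_complex /kick /= => /andP[/eqP -> ].
by rewrite mulr0 addr0 => ->; rewrite eqxx.
Qed.

Lemma phaseM (R : realType) (y z : R[i]) : phase (y * z) = phase y * phase z.
Proof. by rewrite /phase rmorphM /= invfM mulrACA. Qed.

Lemma norm_phase (R : realType) (z : R[i]) : z != 0 -> `|phase z| = 1.
Proof. by move=> z0; rewrite /phase normrM normfV normcJ divff// normr_eq0. Qed.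

Lemma phase_unit (R : realType) (e : R[i]) : `|e| = 1 -> phase e = e ^+ 2.
Proof.
move=> e1; have := sqr_normc e; rewrite e1 expr1n => ee.
have e0 : e^* != 0.
  by rewrite conjc_eq0; apply/eqP => e0; move: e1; rewrite e0 normr0 => /eqP;
     rewrite eq_sym oner_eq0.
by apply/(mulIf e0); rewrite divfK// expr2 -mulrA -ee mulr1.
Qed.

Lemma normc_real (R : realType) (x : R) : `|x%:C| = `|x|%:C.
Proof. by rewrite normc_def /= [X in _ + X]expr2 mulr0 addr0 sqrtr_sqr. Qed.

(* The kick does not move the real part x, and the two phases differ by
   2 i t x^2 over the product of the conjugates. *)
Lemma phase_kick_le (R : realType) (t : R) (z : R[i]) : z != 0 ->
  `|phase (kick t z) - phase z| <= (2 * `|t|)%:C.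
Proof.
move=> z0; have k0 := kick_neq0 t z0; set y := kick t z in k0 *.
have eqRe : Re y = Re z by [].
have y0' : y^* != 0 by rewrite conjc_eq0.
have z0' : z^* != 0 by rewrite conjc_eq0.
have -> : phase y - phase z
   = ('i%C * (2 * t)%:C) * ((Re y)%:C * (Re z)%:C) / (y^* * z^*).
  rewrite /phase -mulNr addf_div//; congr (_ / _).
  rewrite /y /kick; case: (z) => a b; apply/eqP; rewrite eq_complex /=.
  by apply/andP; split; apply/eqP; ring.
rewrite normrM normfV ler_pdivrMr ?normr_gt0 ?mulf_neq0//.
rewrite [leLHS]normrM; apply: ler_pM => //.
  by rewrite normrM complexiE normCi mul1r normc_real normrM ger0_norm.
rewrite !normrM !normcJ !normc_real; apply: ler_pM;
  rewrite ?ler0c ?normr_ge0 //.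
  exact: normc_ge_Re.
by rewrite eqRe; exact: normc_ge_Re.
Qed.

Lemma Im_phase (R : realType) (z : R[i]) :
  z != 0 -> Im (phase z) = 2 * Re z * Im z / sqnorm z.
Proof.
move=> /sqnorm_gt0 /lt0r_neq0; case: z => x y; rewrite /sqnorm /phase /= => h.
by field.
Qed.

(** The exact growth factor is [1 + t Im (phase z) + t^2 (Re z)^2 / sqnorm z]. The last fraction is
    at most 1, and [1 + x <= e^x]. *)
Lemma sqnorm_kick_le (R : realType) (t : R) (z : R[i]) : z != 0 ->
  sqnorm (kick t z) <= sqnorm z * expR (t * Im (phase z) + t ^+ 2).
Proof.
move=> z0; have s0 := sqnorm_gt0 z0.
apply: le_trans (ler_wpM2l (ltW s0) (expR_ge1Dx _)).
rewrite Im_phase// !mulrDr mulr1.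
have -> : sqnorm z * (t * (2 * Re z * Im z / sqnorm z)) = t * (2 * Re z * Im z).
  by field; rewrite lt0r_neq0.
rewrite /sqnorm /kick /=.
have := mulr_ge0 (sqr_ge0 (Im z)) (sqr_ge0 t); lra.
Qed.

Lemma normc_Im_le (R : realType) (z : R[i]) : `|z| <= 1 -> `|Im z| <= 1.
Proof.
rewrite normc_def lecR => h; apply: le_trans h.
by rewrite -sqrtr_sqr ler_wsqrtr// lerDr sqr_ge0.
Qed.

(** Product-to-sum formula: it separates the difference frequency from the sum frequency. *)
Lemma Im_mul_Im (R : realType) (y z : R[i]) :
  Im y * Im z = (Re (y * z^*) - Re (y * z)) / 2.
Proof. by case: y z => a b [c d] /=; field. Qed.

(* The choice of perturbation: [feedback] makes [ln (sqnorm (z j))] drift by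
   [- 4 Im (phase (z j)) ^+ 2 / m.+1], up to oscillating and summable terms. *)
Definition feedback (R : realType) (N : nat) (kappa : 'I_N -> R) (m : nat)
    (z : 'I_N -> R[i]) : R :=
  - 4 * m.+1%:R^-1 * \sum_i Im (phase (z i)) / kappa i.

(** One scalar [feedback] drives all components, because the same potential acts at every energy;
    this is their only coupling. *)
Fixpoint feedback_orbit (R : realType) (N : nat) (kappa : 'I_N -> R)
    (e z0 : 'I_N -> R[i]) (m : nat) : 'I_N -> R[i] :=
  if m is m'.+1 then
    let z := feedback_orbit kappa e z0 m' in
    fun j => e j * kick (kappa j * feedback kappa m' z) (z j)
  else z0.

Lemma feedback_le (R : realType) (N : nat) (kappa : 'I_N -> R) (m : nat)
    (z : 'I_N -> R[i]) : (forall j, z j != 0) ->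
  `|feedback kappa m z| <= 4 * (\sum_i `|kappa i|^-1) * m.+1%:R^-1.
Proof.
move=> z0; rewrite /feedback !normrM normrN (ger0_norm (_ : 0 <= 4))//.
rewrite mulrAC (@ger0_norm _ m.+1%:R^-1)// ler_wpM2r// ler_wpM2l//.
apply: le_trans (ler_norm_sum _ _ _) _; apply: ler_sum => i _.
rewrite normrM normfV ler_piMl ?invr_ge0//.
by apply: normc_Im_le; rewrite norm_phase.
Qed.

Section FeedbackOrbit.
Context (R : realType) (N : nat) (kappa : 'I_N -> R) (e z0 : 'I_N -> R[i]).
Context (e1 : forall j, `|e j| = 1).
Context (z0_neq0 : forall j, z0 j != 0).

Local Notation z := (feedback_orbit kappa e z0).
Local Notation beta m := (feedback kappa m (z m)).

Lemma norm1_neq0 (x : R[i]) : `|x| = 1 -> x != 0.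
Proof. by move=> x1; rewrite -normr_eq0 x1 oner_eq0. Qed.

Lemma feedback_orbit_neq0 m j : z m j != 0.
Proof.
elim: m j => [|m IHm] j //=.
by apply: mulf_neq0; [exact: norm1_neq0 | exact: kick_neq0].
Qed.

Lemma phase_step j : exists K, forall m,
  `|phase (z m.+1 j) - e j ^+ 2 * phase (z m j)| <= (K * m.+1%:R^-1)%:C.
Proof.
exists (2 * (`|kappa j| * (4 * \sum_i `|kappa i|^-1))) => m /=.
rewrite phaseM phase_unit// -mulrBr normrM normrX e1 expr1n mul1r.
apply: le_trans (phase_kick_le _ (feedback_orbit_neq0 m j)) _.
rewrite lecR -!mulrA ler_wpM2l// normrM ler_wpM2l// mulrA.
exact/feedback_le/feedback_orbit_neq0.
Qed.

Lemma norm_phase_orbit m j : `|phase (z m j)| = 1.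
Proof. exact/norm_phase/feedback_orbit_neq0. Qed.

(** The product of two phases is again nearly rotated at each step, by [(e i * e j) ^+ 2]. All
    factors have modulus 1, so the two [O(1 / m)] errors simply add. *)
Lemma phase_mul_sum_bounded i j : (e i * e j) ^+ 2 != 1 ->
  exists B, forall n,
    `|\sum_(m < n) Re (phase (z m i) * phase (z m j)) * m.+1%:R^-1| <= B.
Proof.
move=> eij; have [Ki hi] := phase_step i; have [Kj hj] := phase_step j.
apply: (@oscillating_sum_bounded _ (fun m => phase (z m i) * phase (z m j))
  _ (Ki + Kj) eij) => m.
  by rewrite normrM !norm_phase_orbit mulr1.
set x := phase (z m.+1 i); set y := phase (z m.+1 j).
set x' := phase (z m i); set y' := phase (z m j).
rewrite (_ : _ - _ = (x - e i ^+ 2 * x') * y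
    + e i ^+ 2 * x' * (y - e j ^+ 2 * y')); last by ring.
rewrite (_ : ((Ki + Kj) * _)%:C
  = (Ki * m.+1%:R^-1)%:C + (Kj * m.+1%:R^-1)%:C); last first.
  by rewrite mulrDl rmorphD.
apply: le_trans (ler_normD _ _) _; rewrite lerD//.
  rewrite normrM norm_phase_orbit mulr1; exact: hi.
have n1 : `|e i ^+ 2 * x'| = 1.
  by rewrite normrM normrX e1 expr1n mul1r; exact: norm_phase_orbit.
by rewrite normrM n1 mul1r; exact: hj.
Qed.

(** As for the plain product, except that conjugation inverts the unit number [e j]. *)
Lemma phase_mul_conj_sum_bounded i j : (e i / e j) ^+ 2 != 1 ->
  exists B, forall n,
    `|\sum_(m < n) Re (phase (z m i) * (phase (z m j))^*) * m.+1%:R^-1| <= B.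
Proof.
move=> eij; have [Ki hi] := phase_step i; have [Kj hj] := phase_step j.
apply: (@oscillating_sum_bounded _ (fun m => phase (z m i) * (phase (z m j))^*)
  _ (Ki + Kj) eij) => m.
  by rewrite normrM normcJ !norm_phase_orbit mulr1.
set x := phase (z m.+1 i); set y := phase (z m.+1 j).
set x' := phase (z m i); set y' := phase (z m j).
have conj_sub_sqrM (u v w : R[i]) :
    (u - w ^+ 2 * v)^* = u^* - (w^*) ^+ 2 * v^*.
  by rewrite rmorphB rmorphM rmorphXn.
have ej : (e j)^-1 = (e j)^*.
  by rewrite invc_norm e1 expr1n invr1 mul1r.
rewrite (_ : _ - _ = (x - e i ^+ 2 * x') * y^*
    + e i ^+ 2 * x' * (y - e j ^+ 2 * y')^*); last first.
  by rewrite [X in _ + _ * X](conj_sub_sqrM y y' (e j)) ej; ring.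
rewrite (_ : ((Ki + Kj) * _)%:C
  = (Ki * m.+1%:R^-1)%:C + (Kj * m.+1%:R^-1)%:C); last first.
  by rewrite mulrDl rmorphD.
apply: le_trans (ler_normD _ _) _; rewrite lerD//.
  rewrite normrM normcJ norm_phase_orbit mulr1; exact: hi.
have n1 : `|e i ^+ 2 * x'| = 1.
  by rewrite normrM normrX e1 expr1n mul1r; exact: norm_phase_orbit.
by rewrite normrM normcJ n1 mul1r; exact: hj.
Qed.

End FeedbackOrbit.
(** The product of the factors [1 + 1 / (m + 1)] telescopes to [n + 1]. This converts a harmonic
    drift in the exponent into power decay. *)
Lemma expR_harmonic_ge (R : realType) (n : nat) :
  n.+1%:R <= expR (\sum_(m < n) (m.+1%:R^-1 : R)).
Proof.
elim: n => [|n IHn]; first by rewrite big_ord0 expR0.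
rewrite big_ord_recr /= expRD -[leLHS](_ : n.+1%:R * (1 + n.+1%:R^-1) = _).
  by rewrite ler_pM ?addr_ge0 ?invr_ge0 ?expR_ge1Dx.
by rewrite mulrDr mulr1 divff// natr1.
Qed.

(** * Power decay of the orbit *)

Section Decay.
Context (R : realType) (N : nat) (kappa : 'I_N -> R) (e z0 : 'I_N -> R[i]).
Context (e1 : forall j, `|e j| = 1).
Context (z0_neq0 : forall j, z0 j != 0).
Context (e_sum : forall i j, (e i * e j) ^+ 2 != 1).
Context (e_diff : forall i j, i != j -> (e i / e j) ^+ 2 != 1).
Context (kappa_neq0 : forall j, kappa j != 0).

Local Notation z := (feedback_orbit kappa e z0).
Local Notation beta m := (feedback kappa m (z m)).

(** After [Im_mul_Im] every term oscillates except the conjugate product for [i = j], which is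
    identically 1. Half of it is the mean value subtracted here. *)
Lemma cross_sum_bounded i j : exists B, forall n,
  `|\sum_(m < n) Im (phase (z m i)) * Im (phase (z m j)) * m.+1%:R^-1
    - (i == j)%:R / 2 * \sum_(m < n) m.+1%:R^-1| <= B.
Proof.
have [Bs hs] := phase_mul_sum_bounded kappa e1 z0_neq0 (e_sum i j).
have [Bd hd] : exists B, forall n,
  `|\sum_(m < n) Re (phase (z m i) * (phase (z m j))^*) * m.+1%:R^-1
    - (i == j)%:R * \sum_(m < n) m.+1%:R^-1| <= B.
  have [<-|ij] := eqVneq i j.
    exists 0 => n; rewrite mul1r -sumrB big1 ?normr0// => m _.
    rewrite -sqr_normc norm_phase_orbit// expr1n.
    by rewrite mul1r subrr.
  have [B hB] := phase_mul_conj_sum_bounded kappa e1 z0_neq0 (e_diff ij).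
  by exists B => n; rewrite mul0r subr0.
exists ((Bd + Bs) / 2) => n.
rewrite (_ : _ - _ =
   ((\sum_(m < n) Re (phase (z m i) * (phase (z m j))^*) * m.+1%:R^-1
    - (i == j)%:R * \sum_(m < n) m.+1%:R^-1)
   - \sum_(m < n) Re (phase (z m i) * phase (z m j)) * m.+1%:R^-1) / 2).
  rewrite normrM (@ger0_norm _ 2^-1)// ler_wpM2r//.
  by apply: le_trans (ler_normB _ _) _; rewrite lerD.
rewrite [X in _ = X / 2]addrAC -sumrB mulrBl mulr_suml mulrAC; congr (_ - _).
by apply: eq_bigr => m _; rewrite Im_mul_Im; ring.
Qed.

(** Multiplication by [kappa j] turns the weights [1 / kappa i] of [feedback] into
    [kappa j / kappa i], equal to 1 for [i = j]. The drift is thus -4 times the mean 1/2 for every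
    [j]; the cross terms and the squares have bounded sums. *)
Lemma exponent_sum_le j : exists K, forall n,
  \sum_(m < n) (kappa j * beta m * Im (phase (z m j))
    + (kappa j * beta m) ^+ 2) <= K - 2 * \sum_(m < n) m.+1%:R^-1.
Proof.
have /fin_all_exists[B hB] := fun i => cross_sum_bounded i j.
pose C := `|kappa j| * (4 * \sum_i `|kappa i|^-1).
exists (\sum_i 4 * `|kappa j / kappa i| * B i + C ^+ 2 * 2) => n.
rewrite big_split /= addrAC lerD//; last first.
  apply: le_trans (ler_wpM2l (sqr_ge0 C) (sum_sqr_harmonic_le R n)).
  rewrite mulr_sumr; apply: ler_sum => m _.
  rewrite -exprMn -[leLHS]real_normK ?num_real// ler_sqr ?nnegrE//; last first.
    by rewrite !mulr_ge0// sumr_ge0// => i _; rewrite invr_ge0.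
  by rewrite normrM /C -mulrA ler_wpM2l// feedback_le// => i;
     exact: feedback_orbit_neq0.
rewrite lerBrDr.
apply: le_trans (_ : \sum_i `|- 4 * (kappa j / kappa i) *
  (\sum_(m < n) Im (phase (z m i)) * Im (phase (z m j)) * m.+1%:R^-1
    - (i == j)%:R / 2 * \sum_(m < n) m.+1%:R^-1)| <= _); last first.
  apply: ler_sum => i _; rewrite normrM ler_pM//.
  by rewrite normrM normrN (@ger0_norm _ 4).
apply: le_trans (ler_norm_sum _ _ _); apply: le_trans (ler_norm _).
under [leRHS]eq_bigr do rewrite mulrBr.
rewrite sumrB lerD// /feedback.
  rewrite le_eqVlt; apply/orP; left; apply/eqP.
  under [RHS]eq_bigr do rewrite mulr_sumr.
  rewrite exchange_big /=; apply: eq_bigr => m _.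
  rewrite !mulr_sumr mulr_suml; apply: eq_bigr => i _; ring.
rewrite (bigD1 j)//= [X in _ + X]big1 ?addr0; last first.
  by move=> i ij; rewrite (negPf ij) !mul0r mulr0.
rewrite eqxx lerNr; rewrite le_eqVlt; apply/orP; left; apply/eqP.
by rewrite divff// mulr1n; field.
Qed.

Lemma sqnorm_orbit_le n j : sqnorm (z n j) <= sqnorm (z0 j) *
  expR (\sum_(m < n) (kappa j * beta m * Im (phase (z m j))
    + (kappa j * beta m) ^+ 2)).
Proof.
elim: n => [|n IHn]; first by rewrite big_ord0 expR0 mulr1.
have e1' : sqnorm (e j) = 1.
  by apply/complexI; rewrite /sqnorm add_Re2_Im2 e1 expr1n.
rewrite big_ord_recr /= sqnormM e1' mul1r expRD mulrA.
apply: le_trans (sqnorm_kick_le _ (feedback_orbit_neq0 _ _ _ _ _)) _ => //.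
by rewrite ler_wpM2r// expR_ge0.
Qed.

Lemma sqnorm_orbit_decay j : exists B, forall n,
  sqnorm (z n j) <= B * n.+1%:R^-1 ^+ 2.
Proof.
have [K hK] := exponent_sum_le j.
exists (sqnorm (z0 j) * expR K) => n.
apply: le_trans (sqnorm_orbit_le n j) _.
rewrite -mulrA ler_wpM2l//; first by rewrite addr_ge0 ?sqr_ge0.
apply: (@le_trans _ _ (expR (K - 2 * \sum_(m < n) m.+1%:R^-1))).
  by rewrite ler_expR.
rewrite expRD ler_wpM2l ?expR_ge0// expRN exprVn lef_pV2 ?posrE ?expR_gt0//.
  by rewrite expRM_natl ler_sqr ?nnegrE ?expR_ge0// expR_harmonic_ge.
Qed.

End Decay.

(** * Floquet theory in the bands *)

Fixpoint jacobi_ivp_pair (F : fieldType) (a b : nat -> F) (E x0 x1 : F)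
    (n : nat) : F * F :=
  if n is m.+1 then
    let: (x, y) := jacobi_ivp_pair a b E x0 x1 m in
    (y, ((E - b m.+2) * y - a m.+1 * x) / a m.+2)
  else (x0, x1).

Definition jacobi_ivp (F : fieldType) (a b : nat -> F) (E x0 x1 : F)
    (n : nat) : F :=
  (jacobi_ivp_pair a b E x0 x1 n).1.

Lemma jacobi_ivpE (F : fieldType) (a b : nat -> F) (E x0 x1 : F) (n : nat) :
  let u := jacobi_ivp a b E x0 x1 in
  u n.+2 = ((E - b n.+2) * u n.+1 - a n.+1 * u n) / a n.+2.
Proof. by rewrite /jacobi_ivp /=; case: (jacobi_ivp_pair a b E x0 x1 n). Qed.

Lemma jacobi_ivp_solution (F : fieldType) (a b : nat -> F) (E x0 x1 : F) :
  (forall n, (1 <= n)%N -> a n != 0) ->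
  jacobi_solution a b E (jacobi_ivp a b E x0 x1).
Proof.
move=> a0 [//|n] _; rewrite /jacobi jacobi_ivpE /=.
by field; exact: a0.
Qed.

(** The morphism and the finite range of sites serve two uses: complex solutions over real
    coefficients, and a real solution followed through a single period. *)
Lemma jacobi_superposition (F K : fieldType) (f : {rmorphism F -> K})
    (a b : nat -> F) (E : F) (u : nat -> K) (q : nat) :
  (forall n, (1 <= n)%N -> a n != 0) ->
  (forall n, (1 <= n <= q)%N ->
     jacobi (f \o a) (f \o b) u n = f E * u n) ->
  forall n, (n <= q.+1)%N ->
    u n = u 1%N * f (jacobi_ivp a b E 0 1 n)
          + u 0%N * f (jacobi_ivp a b E 1 0 n).
Proof.
move=> a0 hu.
suff H n : (n <= q)%N ->
    u n = u 1%N * f (jacobi_ivp a b E 0 1 n)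
          + u 0%N * f (jacobi_ivp a b E 1 0 n) /\
    u n.+1 = u 1%N * f (jacobi_ivp a b E 0 1 n.+1)
             + u 0%N * f (jacobi_ivp a b E 1 0 n.+1).
  by case=> [_|n nq]; [have [] := H 0%N (leq0n _) | have [] := H n nq].
elim: n => [_|n IHn nq].
  by rewrite /jacobi_ivp /= !rmorph0 !rmorph1 !mulr0 !mulr1 add0r addr0.
have [un un1] := IHn (ltnW nq); split=> //.
have := hu n.+1 nq; rewrite /jacobi /= => hn.
have fa : f (a n.+2) != 0 by rewrite fmorph_eq0 a0.
have -> : u n.+2
    = ((f E - f (b n.+2)) * u n.+1 - f (a n.+1) * u n) / f (a n.+2).
  apply/(mulIf fa); rewrite divfK// mulrBl -hn; ring.
rewrite un un1 !jacobi_ivpE !fmorph_div !rmorphB !rmorphM !rmorphB /=; ring.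
Qed.

Lemma monodromyE (R : realType) (q : nat) (a b : nat -> R) (E : R) :
  let s := jacobi_ivp a b E 0 1 in let c := jacobi_ivp a b E 1 0 in
  monodromy q a b E = \matrix_(i, j)
    if i == 0 then if j == 0 then s q.+1 else c q.+1
    else if j == 0 then s q else c q.
Proof.
move=> s c; rewrite /monodromy; elim: q => [|q IHq].
  rewrite big_nil; apply/matrixP => i j; rewrite !mxE /s /c /jacobi_ivp /=.
  by case: i j => [[|[|//]] ?] [[|[|//]] ?].
have -> : rev (iota 1 q.+1) = q.+1 :: rev (iota 1 q).
  by rewrite -{1}[q.+1]addn1 iotaD rev_cat /= add1n.
rewrite big_cons IHq.
apply/matrixP => i j; rewrite !mxE !big_ord_recl big_ord0 !mxE /=.
rewrite /s /c !jacobi_ivpE.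
by case: i j => [[|[|//]] ?] [[|[|//]] ?] /=; ring.
Qed.

Lemma discriminantE (R : realType) (q : nat) (a b : nat -> R) (E : R) :
  discriminant q a b E = jacobi_ivp a b E 0 1 q.+1 + jacobi_ivp a b E 1 0 q.
Proof.
by rewrite /discriminant monodromyE /mxtrace !big_ord_recl big_ord0 !mxE addr0.
Qed.

Lemma wronskianE (F : fieldType) (a b : nat -> F) (E : F) (n : nat) :
  (forall n, (1 <= n)%N -> a n != 0) ->
  let s := jacobi_ivp a b E 0 1 in let c := jacobi_ivp a b E 1 0 in
  a n.+1 * (s n.+1 * c n - s n * c n.+1) = a 1%N.
Proof.
move=> a0 s c; elim: n => [|n <-].
  by rewrite /s /c /jacobi_ivp /=; ring.
by rewrite /s /c !jacobi_ivpE; field; exact: a0.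
Qed.

Lemma expiD (R : realType) (x y : R) : expi (x + y) = expi x * expi y.
Proof.
apply/eqP; rewrite /expi eq_complex /= cosD sinD eqxx /=.
by apply/eqP; ring.
Qed.

Lemma norm_expi (R : realType) (x : R) : `|expi x| = 1.
Proof. by rewrite normc_def /= cos2Dsin2 sqrtr1. Qed.

Lemma expi0 (R : realType) : expi 0 = 1 :> R[i].
Proof. by rewrite /expi cos0 sin0. Qed.

Lemma expiN (R : realType) (x : R) : expi (- x) = (expi x)^-1.
Proof.
apply/(mulIf (norm1_neq0 (norm_expi x))).
by rewrite -expiD addNr expi0 mulVf// norm1_neq0// norm_expi.
Qed.

Lemma expi_neq0 (R : realType) (x : R) : expi x != 0.
Proof. exact/norm1_neq0/norm_expi. Qed.

Lemma expi_sqr_eq1 (R : realType) (x : R) : expi x ^+ 2 = 1 -> sin x = 0.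
Proof.
move=> [h _]; have := cos2Dsin2 x; move: h => /= h1 h2.
by apply/eqP; rewrite -sqrf_eq0; apply/eqP; lra.
Qed.

Lemma expi_sqrD1 (R : realType) (x : R) :
  expi x ^+ 2 + 1 = (2 * cos x)%:C * expi x.
Proof.
have h := cos2Dsin2 x; apply/eqP; rewrite eq_complex /=.
by apply/andP; split; apply/eqP; [lra | ring].
Qed.

(** * Monodromy, quasimomentum and elliptic coordinate *)

Section Floquet.
Context (R : realType) (q : nat) (a b : nat -> R) (E : R).
Context (q_ge1 : (1 <= q)%N) (a_per : periodic_from1 q a).
Context (b_per : periodic_from1 q b).
Context (a_gt0 : forall n, (1 <= n)%N -> 0 < a n).

Local Notation s := (jacobi_ivp a b E 0 1).
Local Notation c := (jacobi_ivp a b E 1 0).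
Local Notation phi x y := (fun n => x * (s n)%:C + y * (c n)%:C).
Local Notation aC := (fun n => (a n)%:C).
Local Notation bC := (fun n => (b n)%:C).

Lemma a_neq0 n : (1 <= n)%N -> a n != 0.
Proof. by move=> /a_gt0 /lt0r_neq0. Qed.

Lemma det_monodromy : s q.+1 * c q - s q * c q.+1 = 1.
Proof.
have := wronskianE b E q a_neq0; rewrite /= -(add1n q) a_per//.
by move=> h; apply/(mulfI (a_neq0 (leqnn 1))); rewrite mulr1.
Qed.

Lemma complex_superposition (u : nat -> R[i]) :
  jacobi_solution aC bC E%:C u -> forall n, u n = phi (u 1%N) (u 0%N) n.
Proof.
move=> hu n.
apply: (@jacobi_superposition _ _ (real_complex R) a b E u n a_neq0) => //.
by move=> m /andP[m1 _]; exact: hu.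
Qed.

(** The initial data of a Floquet solution form an eigenvector of the monodromy for [expi k]. As the
    determinant is 1, dividing the characteristic equation by [expi k] leaves [2 cos k] equal to the
    trace. *)
Lemma quasimomentum_disc k : is_quasimomentum q a b E k ->
  2 * cos k = discriminant q a b E.
Proof.
case=> k_itv [p [p_per [n0 pn0] hu]].
set u := fun n => p n * expi (k / q%:R * n%:R) in hu.
have q0 : q%:R != 0 :> R by rewrite pnatr_eq0 -lt0n.
have u_per n : u (n + q)%N = expi k * u n.
  rewrite /u p_per natrD mulrDr expiD divfK//; ring.
have uE := complex_superposition hu.
have k0 : sin k != 0 by rewrite lt0r_neq0// sin_gt0_pi.
have h1 := uE q.+1; rewrite -(add1n q) u_per add1n in h1.
have h0 := uE q; rewrite -(add0n q) u_per add0n in h0.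
have det := congr1 (real_complex R) det_monodromy.
rewrite rmorphB !rmorphM rmorph1 /= in det.
rewrite discriminantE.
set S := (s q.+1)%:C in h1 det; set B := (c q.+1)%:C in h1 det.
set C := (s q)%:C in h0 det; set D := (c q)%:C in h0 det.
have char x : x = u 1%N \/ x = u 0%N ->
    x * (expi k ^+ 2 + 1 - (S + D) * expi k) = 0.
  case=> ->; rewrite -det.
    transitivity ((expi k * u 1%N - u 1%N * S) * (expi k - D) - u 1%N * C * B).
      ring.
    rewrite h1; transitivity (B * (expi k * u 0%N - u 0%N * D - u 1%N * C)).
      ring.
    rewrite h0; ring.
  transitivity ((expi k * u 0%N - u 0%N * D) * (expi k - S) - u 0%N * C * B).
    ring.
  rewrite h0; transitivity (C * (expi k * u 1%N - u 1%N * S - u 0%N * B)).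
    ring.
  rewrite h1; ring.
have : expi k ^+ 2 + 1 - (S + D) * expi k = 0.
  have [u1|u1] := eqVneq (u 1%N) 0; last first.
    by apply/(mulfI u1); rewrite mulr0; apply: char; left.
  have [u0|u0] := eqVneq (u 0%N) 0; last first.
    by apply/(mulfI u0); rewrite mulr0; apply: char; right.
  have := uE n0; rewrite u1 u0 !mul0r addr0 => /eqP.
  by rewrite mulf_eq0 (negPf pn0) (negPf (expi_neq0 _)).
rewrite expi_sqrD1 -rmorphD /= => /eqP; rewrite subr_eq0 => /eqP.
by move=> /(mulIf (expi_neq0 _)) [].
Qed.

Context (E_band : `|discriminant q a b E| < 2).

(** Otherwise the monodromy is triangular with [s q.+1 * c q = 1], and the squared trace
    [(s q.+1 - c q)^2 + 4] is at least 4, outside the band. *)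
Lemma offdiag_neq0 : c q.+1 != 0.
Proof.
apply/eqP => c0; have := det_monodromy; rewrite c0 mulr0 subr0 => h.
have := E_band; rewrite discriminantE.
rewrite -ltr_sqr ?nnegrE// real_normK ?num_real// => h2.
have := sqr_ge0 (s q.+1 - c q); nra.
Qed.

Lemma ex_quasimomentum : exists k, is_quasimomentum q a b E k.
Proof.
have /andP[d1 d2] : -1 < discriminant q a b E / 2 < 1.
  by move: E_band; rewrite ltr_norml => /andP[? ?]; apply/andP; split; lra.
set k := acos (discriminant q a b E / 2).
have kd : 2 * cos k = discriminant q a b E.
  by rewrite /k acosK ?in_itv/= ?(ltW d1) ?(ltW d2)//; field.
exists k; split.
  by rewrite acos_gt0 ?acos_ltpi ?d1 ?d2 ?(ltW d1) ?(ltW d2).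
have det := congr1 (real_complex R) det_monodromy.
rewrite rmorphB !rmorphM rmorph1 /= in det.
have char := expi_sqrD1 k.
rewrite kd discriminantE rmorphD /= in char.
(* [(x, y)] is the eigenvector of the monodromy for [expi k] read off its first row. *)
set x := (c q.+1)%:C; set y := expi k - (s q.+1)%:C.
set u := phi x y.
have u_sol : jacobi_solution aC bC E%:C u.
  move=> n n1.
  have hs := congr1 (real_complex R) (jacobi_ivp_solution b E 0 1 a_neq0 n1).
  have hc := congr1 (real_complex R) (jacobi_ivp_solution b E 1 0 a_neq0 n1).
  move: hs hc; rewrite /jacobi !rmorphD !rmorphM /= => hs hc.
  rewrite /jacobi /u [RHS](_ : _ =
    x * (E%:C * (s n)%:C) + y * (E%:C * (c n)%:C)); last by ring.
  rewrite -hs -hc; ring.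
have u1 : u 1%N = x by rewrite /u /jacobi_ivp /= mulr1 mulr0 addr0.
have u0 : u 0%N = y by rewrite /u /jacobi_ivp /= mulr1 mulr0 add0r.
(* The shifted sequence solves the same periodic equation, so only its values at 0 and 1 have to be
   compared. *)
have u_per n : u (n + q)%N = expi k * u n.
  have v_sol : jacobi_solution aC bC E%:C (fun n => u (n + q)%N).
    case=> [//|m] _; have := u_sol (m.+1 + q)%N isT.
    rewrite /jacobi -[(m.+1 + q).+1]/(m.+2 + q)%N -[(m.+1 + q).-1]/(m + q)%N.
    by rewrite !a_per// b_per.
  rewrite (complex_superposition v_sol n) {1 2}/u add1n add0n.
  rewrite [u n]/u {3}/y.
  have e2 : expi k ^+ 2 = ((s q.+1)%:C + (c q)%:C) * expi k - 1.
    by rewrite -char addrK.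
  have -> : x * (s q)%:C + y * (c q)%:C = expi k * y.
    rewrite /x /y mulrBr -expr2 e2 -det; ring.
  rewrite /x /y; ring.
have q0 : q%:R != 0 :> R by rewrite pnatr_eq0 -lt0n.
exists (fun n => u n * expi (- (k / q%:R * n%:R))); split.
- move=> n; rewrite u_per (_ : k / q%:R * (n + q)%:R = k / q%:R * n%:R + k).
    rewrite opprD expiD [expi (- k)]expiN [expi k * _]mulrC.
    by rewrite mulrACA mulfV ?expi_neq0// mulr1.
  by rewrite natrD mulrDr divfK.
- exists 1%N; rewrite u1 mulf_neq0 ?expi_neq0//.
  by rewrite (inj_eq (@complexI R) _ 0) offdiag_neq0.
- rewrite (_ : (fun n => _ * expi _) = u)//; apply/funext => n.
  by rewrite expiN divfK// expi_neq0.
Qed.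

Lemma quasimomentumP (k := quasimomentum q a b E) :
  0 < k < pi /\ 2 * cos k = discriminant q a b E.
Proof.
have hk : is_quasimomentum q a b E k by exact: (xgetPex 0 ex_quasimomentum).
by split; [case: hk | exact: quasimomentum_disc].
Qed.

(* The real part of [f] is x, so the perturbation, which only shears y by a
   multiple of x, becomes a kick; [f] diagonalizes the monodromy. *)
Lemma elliptic_coordinate (k := quasimomentum q a b E) :
  exists (kappa K : R) (f : R -> R -> R[i]),
  [/\ kappa != 0,
      forall x y, f (x * s q.+1 + y * c q.+1) (x * s q + y * c q)
        = expi k * f x y,
      forall x y t, f x (y + t * x) = kick (kappa * t) (f x y)
    & forall x y, x ^+ 2 + y ^+ 2 <= K * sqnorm (f x y)].
Proof.
have [k_itv kd] := quasimomentumP; rewrite -/k in k_itv kd.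
have sk : sin k != 0 by rewrite lt0r_neq0// sin_gt0_pi.
(* These values are forced by the real part of the required identity for
   [f x y = x + i (kappa y + tau x)]. Its imaginary part then follows from determinant 1 and trace
   [2 cos k]. *)
pose kappa := - c q.+1 / sin k; pose tau := (cos k - s q.+1) / sin k.
have kappa0 : kappa != 0.
  by rewrite mulf_neq0 ?oppr_eq0 ?offdiag_neq0 ?invr_neq0.
exists kappa, (1 + 2 * (1 + tau ^+ 2) / kappa ^+ 2),
  (fun x y => x +i* (kappa * y + tau * x)); split => //.
- move=> x y; have det := det_monodromy; have cs := cos2Dsin2 k.
  move: kd; rewrite discriminantE => kd.
  have cqE : c q = 2 * cos k - s q.+1 by rewrite kd addrC addKr.
  apply/eqP; rewrite eq_complex /= /kappa /tau; apply/andP; split; apply/eqP.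
    by field.
  apply/(mulIf sk).
  transitivity (- c q.+1 * (x * s q + y * c q)
    + (cos k - s q.+1) * (x * s q.+1 + y * c q.+1)); first by field.
  transitivity (sin k ^+ 2 * x
     + cos k * (- c q.+1 * y + (cos k - s q.+1) * x)); last by field.
  have -> : sin k ^+ 2 = s q.+1 * c q - s q * c q.+1 - cos k ^+ 2.
    by rewrite det -cs addrC addKr.
  rewrite cqE; ring.
- by move=> x y t; rewrite /kick /=; congr (_ +i* _); ring.
- move=> x y; rewrite /sqnorm /=.
  set w := kappa * y + tau * x.
  (* The constant comes from [(w - tau x)^2 <= 2 (1 + tau^2) (x^2 + w^2)]. *)
  have -> : y = (w - tau * x) / kappa by rewrite /w; field.
  rewrite expr_div_n mulrDl mul1r.
  rewrite (_ : 2 * (1 + tau ^+ 2) / kappa ^+ 2 * _ =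
    2 * (1 + tau ^+ 2) * (x ^+ 2 + w ^+ 2) / kappa ^+ 2);
    last by rewrite mulrAC.
  apply: lerD; first by rewrite lerDl sqr_ge0.
  rewrite ler_wpM2r ?invr_ge0 ?sqr_ge0//.
  have := sqr_ge0 (w + tau * x); have := sqr_ge0 (tau * w); nra.
Qed.

End Floquet.

(** * Sparse perturbations *)

Lemma square_summable_decay (R : realType) (q : nat) (u : nat -> R) (K : R) :
  (1 <= q)%N ->
  (forall m r, (1 <= r <= q)%N ->
     u (m * q + r)%N ^+ 2 <= K * m.+1%:R^-1 ^+ 2) ->
  square_summable u.
Proof.
move=> q1 hu.
have K0 : 0 <= K.
  have := hu 0%N 1%N q1; rewrite invr1 expr1n mulr1.
  by apply: le_trans; exact: sqr_ge0.
(* Here [n + 1 = m q + r] with [m = n / q] rounded down and [1 <= r <= q], so [n + 1 <= q (m + 1)].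
   The value [u 0] lies in no block and is added separately. *)
have uS n : u n.+1 ^+ 2 <= K * q%:R ^+ 2 * n.+1%:R^-1 ^+ 2.
  have := hu (n %/ q)%N (n %% q).+1; rewrite ltn_pmod// addnS -divn_eq.
  move=> /(_ isT)/le_trans; apply; rewrite -mulrA ler_wpM2l// -exprMn.
  rewrite ler_sqr ?nnegrE ?divr_ge0// ler_pdivlMr// mulrC ler_pdivrMr//.
  by rewrite -natrM ler_nat mulnC ltn_ceil.
apply: nondecreasing_is_cvgn.
  by apply: nondecreasing_series => n _ _; rewrite exprn_ge0.
exists (u 0%N ^+ 2 + K * q%:R ^+ 2 * 2) => _ [n _ <-].
rewrite /series /= big_mkord.
apply: (@le_trans _ _ (\sum_(i < n.+1) `|u i| ^+ 2)).
  by rewrite big_ord_recr /= lerDl exprn_ge0.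
rewrite big_ord_recl /= real_normK ?num_real// lerD2l.
apply: le_trans (ler_wpM2l _ (sum_sqr_harmonic_le R n)); last first.
  by rewrite mulr_ge0// sqr_ge0.
rewrite mulr_sumr; apply: ler_sum => i _.
by rewrite real_normK ?num_real//; exact: uS.
Qed.

(* The values [t m] are placed at the indices [m * q + 2], i.e. in the first
   step of each period of the transfer matrices. *)
Definition sparse_potential (R : realType) (q : nat) (t : nat -> R) (n : nat) :
    R :=
  if (2 <= n)%N && (q %| n - 2)%N then t ((n - 2) %/ q)%N else 0.

Lemma sparse_potentialE (R : realType) (q : nat) (t : nat -> R) (m n : nat) :
  (n < q)%N ->
  sparse_potential q t (m * q + n).+2 = if n == 0%N then t m else 0.
Proof.
move=> nq; rewrite /sparse_potential /= subSS subSS subn0.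
rewrite dvdn_addr ?dvdn_mull//; case: n nq => [|n] nq.
  by rewrite dvdn0 addn0 mulnK.
by rewrite gtnNdvd.
Qed.

Lemma sparse_potential_bigO (R : realType) (q : nat) (t : nat -> R) (B : R) :
  (1 <= q)%N -> (forall m, `|t m| <= B * m.+1%:R^-1) ->
  sparse_potential q t =O_\oo (fun n => (1 + n%:R)^-1 : R).
Proof.
move=> q1 ht.
have B0 : 0 <= B.
  have := ht 0%N; rewrite invr1 mulr1; apply: le_trans; exact: normr_ge0.
(* At [n = m q + 2] one has [n + 1 = m q + 3 <= 3 q (m + 1)]; the extra 1 keeps the constant
   positive even if [B = 0]. *)
apply/eqO_exP; exists (B * (3 * q)%:R + 1).
  by rewrite ltr_wpDl// mulr_ge0.
apply: filterE => n; rewrite nat1r (@ger0_norm _ n.+1%:R^-1)//.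
rewrite /sparse_potential.
case: ifP => [/andP[n2 qn]|_]; last first.
  by rewrite normr0 divr_ge0// addr_ge0// mulr_ge0.
apply: le_trans (ht _) _.
apply: (@le_trans _ _ (B * (3 * q)%:R / n.+1%:R)); last first.
  by rewrite ler_wpM2r// lerDl.
rewrite -mulrA ler_wpM2l// ler_pdivlMr// mulrC ler_pdivrMr// -natrM ler_nat.
have nE : n = ((n - 2) %/ q * q).+2 by rewrite divnK// -addn2 subnK.
rewrite [X in (X < _)%N]nE mulnS -addn3 addnC leq_add//.
  by rewrite leq_pmulr.
by rewrite -mulnA [(q * _)%N]mulnC leq_pmull.
Qed.

Lemma periodic_from1_mul (T : Type) (q : nat) (c : nat -> T) (m n : nat) :
  periodic_from1 q c -> (1 <= n)%N -> c (m * q + n)%N = c n.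
Proof.
move=> c_per n1; elim: m => [//|m IHm].
by rewrite mulSn -addnA addnC c_per// (leq_trans n1)// leq_addl.
Qed.

(* Within a period, the perturbation acts only through the shear
   [u (m q) + beta m * u (m q + 1)] of the initial data. *)
Lemma period_superposition (R : realType) (q : nat) (a b beta u : nat -> R)
    (E : R) :
  periodic_from1 q a -> periodic_from1 q b ->
  (forall n, (1 <= n)%N -> a n != 0) ->
  jacobi_solution a
    (fun n => b n + sparse_potential q (fun m => a 1%N * beta m) n) E u ->
  forall m r, (1 <= r <= q.+1)%N ->
    u (m * q + r)%N = u (m * q + 1)%N * jacobi_ivp a b E 0 1 r
      + (u (m * q)%N + beta m * u (m * q + 1)%N) * jacobi_ivp a b E 1 0 r.
Proof.
move=> a_per b_per a0 hu m [//|r] /andP[_ rq].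
(* In the first equation of the period the perturbation [a 1 * beta m] multiplies [u (m q + 1)] and
   merges with [a 1 * u (m q)]. Changing this single entry therefore yields an unperturbed
   solution. *)
pose w n := if n is _.+1 then u (m * q + n)%N
            else u (m * q)%N + beta m * u (m * q + 1)%N.
rewrite -[LHS]/(w r.+1) -[X in X * _ + _]/(w 1%N) -[X in _ + X * _]/(w 0%N).
apply: (jacobi_superposition (f := idfun) (q := q) a0) rq.
move=> -[//|n] /andP[_ nq].
have := hu (m * q + n.+1)%N; rewrite addnS => /(_ isT).
rewrite /jacobi /= sparse_potentialE// -!addnS.
rewrite !(periodic_from1_mul _ a_per)// (periodic_from1_mul _ b_per)//.
by case: n nq => [|n] nq /=; rewrite ?addn0 => <-; ring.
Qed.

Lemma sqr_comb_le (R : realType) (x y s c : R) :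
  (x * s + y * c) ^+ 2 <= (x ^+ 2 + y ^+ 2) * (s ^+ 2 + c ^+ 2).
Proof. by have := sqr_ge0 (x * c - y * s); lra. Qed.

(** The square is 1 only at multiples of [pi], and the interval contains just 0 and [pi]. It covers
    both sums and differences of two quasimomenta. *)
Lemma expi_sqr_neq1 (R : realType) (t : R) :
  - pi < t < pi *+ 2 -> t != 0 -> t != pi -> expi t ^+ 2 != 1.
Proof.
move=> /andP[tpi t2pi] t0 tp; apply/eqP => /expi_sqr_eq1 st.
have [tlt0|tgt0] := ltP t 0.
  have : 0 < sin (- t) by rewrite sin_gt0_pi// oppr_gt0 tlt0 ltrNl.
  by rewrite sinN st oppr0 ltxx.
have [tltpi|tgtpi] := ltP t pi.
  by have := @sin_gt0_pi R t; rewrite st ltxx tltpi lt_neqAle eq_sym t0 tgt0;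
     move/(_ isT).
have : 0 < sin (t - pi).
  by rewrite sin_gt0_pi// subr_gt0 lt_neqAle eq_sym tp tgtpi ltrBlDr -mulr2n.
move: st; rewrite -{1}[t](subrK pi) sinDpi => /eqP.
by rewrite oppr_eq0 => /eqP ->; rewrite ltxx.
Qed.

(** * The potential and its square-summable solutions *)

Theorem theorem2p8 (R : realType) (q : nat) (q_ge1 : (1 <= q)%N)
    (a b : nat -> R)
    (a_per : periodic_from1 q a) (b_per : periodic_from1 q b)
    (a_gt0 : forall n, (1 <= n)%N -> 0 < a n)
    (N : nat) (E : 'I_N -> R)
    (E_band : forall j, (\bigcup_(I in open_bands q a b) I) (E j))
    (k_inj : forall i j, i != j ->
       quasimomentum q a b (E i) <> quasimomentum q a b (E j))
    (k_sum : forall i j,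
       quasimomentum q a b (E i) + quasimomentum q a b (E j) <> pi)
    (theta : 'I_N -> R) (theta_itv : forall j, 0 <= theta j <= pi) :
  exists b' : nat -> R,
    b' =O_\oo (fun n => (1 + n%:R)^-1 : R) /\
    forall j : 'I_N, exists u : nat -> R,
      [/\ exists n, u n != 0,
          jacobi_solution a (fun n => b n + b' n) (E j) u,
          square_summable u
        & boundary_condition (theta j) u].
Proof.
have a0 n : (1 <= n)%N -> a n != 0 by move=> /a_gt0 /lt0r_neq0.
have disc j : `|discriminant q a b (E j)| < 2.
  by have [_ [x _ <-] /connected_component_sub] := E_band j.
pose k j := quasimomentum q a b (E j).
have k_itv j : 0 < k j < pi.
  by have [] := quasimomentumP q_ge1 a_per b_per a_gt0 (disc j).
have /fin_all_exists[kappa /fin_all_exists[K /fin_all_exists[f hf]]] := fun j =>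
  elliptic_coordinate q_ge1 a_per b_per a_gt0 (disc j).
pose e j := expi (k j).
have e1 j : `|e j| = 1 by exact: norm_expi.
have e_sum i j : (e i * e j) ^+ 2 != 1.
  have /andP[i0 ipi] := k_itv i; have /andP[j0 jpi] := k_itv j.
  rewrite -expiD expi_sqr_neq1//; last 2 first.
  - by rewrite lt0r_neq0// addr_gt0.
  - by apply/eqP; exact: k_sum.
  by rewrite mulr2n; apply/andP; split; lra.
have e_diff i j : i != j -> (e i / e j) ^+ 2 != 1.
  move=> ij; have /andP[i0 ipi] := k_itv i; have /andP[j0 jpi] := k_itv j.
  rewrite -expiN -expiD expi_sqr_neq1//.
  - by rewrite mulr2n; apply/andP; split; lra.
  - by rewrite subr_eq0; apply/eqP; exact: k_inj.
  - by rewrite lt_eqF//; lra.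
have kappa_neq0 j : kappa j != 0 by have [] := hf j.
(* Normalized initial data [(u 0, u 1)]: [(0, 1)] for the angle [pi / 2], and [(1, tan theta)]
   otherwise. *)
pose x0 j : R := if theta j == pi / 2 then 0 else 1.
pose x1 j : R := if theta j == pi / 2 then 1 else tan (theta j).
pose z0 j := f j (x1 j) (x0 j).
have z0_neq0 j : z0 j != 0.
  have [_ _ _ /(_ (x1 j) (x0 j)) h] := hf j; apply: contraTneq h => h.
  rewrite -[f j _ _]/(z0 j) h -ltNge /sqnorm /= expr0n /= addr0 mulr0 /x1 /x0.
  case: ifP => _; first by rewrite expr1n expr0n addr0.
  by rewrite ltr_wpDl ?sqr_ge0// expr1n.
(* The orbit depends on the initial data alone, so the potential can be defined before any solution;
   [zE] later identifies the orbit with the coordinates of the solutions. *)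
pose z := feedback_orbit kappa e z0.
pose beta m := feedback kappa m (z m).
pose b' := sparse_potential q (fun m => a 1%N * beta m).
exists b'; split.
  apply: (@sparse_potential_bigO _ _ _
    (a 1%N * (4 * \sum_i `|kappa i|^-1))) => //.
  move=> m; rewrite normrM gtr0_norm ?a_gt0// -mulrA ler_wpM2l//.
    exact/ltW/a_gt0.
  by apply: feedback_le => i; exact: feedback_orbit_neq0.
move=> j.
have [u [u0 u1 u_sol]] : exists u : nat -> R,
    [/\ u 0%N = x0 j, u 1%N = x1 j
      & jacobi_solution a (fun n => b n + b' n) (E j) u].
  exists (jacobi_ivp a (fun n => b n + b' n) (E j) (x0 j) (x1 j)).
  by split=> //; exact: jacobi_ivp_solution.
exists u; split=> //.
- have [tj|tj] := boolP (theta j == pi / 2).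
    by exists 1%N; rewrite u1 /x1 tj oner_neq0.
  by exists 0%N; rewrite u0 /x0 (negPf tj) oner_neq0.
- have [_ f_step f_kick f_norm] := hf j.
  have u_period := period_superposition a_per b_per a0 u_sol.
  pose w m := u (m * q)%N + beta m * u (m * q + 1)%N.
  have f_next m : z m j = f j (u (m * q + 1)%N) (u (m * q)%N) ->
      z m.+1 j = e j * f j (u (m * q + 1)%N) (w m).
    by move=> zm; rewrite /w f_kick -zm.
  have zE m : z m j = f j (u (m * q + 1)%N) (u (m * q)%N).
    elim: m => [|m /f_next ->]; first by rewrite u0 u1.
    rewrite -f_step mulSn [(q + _)%N]addnC.
    have -> : (m * q + q + 1 = m * q + q.+1)%N by rewrite -addnA addn1.
    by rewrite (u_period m q.+1) ?leqnn// (u_period m q) ?q_ge1 ?leqnSn.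
  have [B hB] := sqnorm_orbit_decay e1 z0_neq0 e_sum e_diff kappa_neq0 j.
  pose s := jacobi_ivp a b (E j) 0 1; pose c := jacobi_ivp a b (E j) 1 0.
  pose M := \sum_(i < q.+1) (s i ^+ 2 + c i ^+ 2).
  have sqr_ge0D (x y : R) : 0 <= x ^+ 2 + y ^+ 2 by rewrite addr_ge0 ?sqr_ge0.
  apply: (@square_summable_decay _ q _ (`|K j| * `|B| * M)) => //
    m r /andP[r1 rq].
  rewrite u_period ?r1 ?leqW//; apply: le_trans (sqr_comb_le _ _ _ _) _.
  rewrite [leRHS]mulrAC; apply: ler_pM => //; last first.
    rewrite /M (bigD1 (Ordinal (rq : (r < q.+1)%N)))//= lerDl.
    by apply: sumr_ge0 => i _; exact: sqr_ge0D.
  apply: le_trans (f_norm _ _) _; rewrite -[leRHS]mulrA.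
  apply: le_trans (ler_wpM2r _ (ler_norm _)) _; first exact: sqr_ge0D.
  rewrite ler_wpM2l//.
  (* The sheared data governing period [m] differ from [z m.+1 j] only by the rotation [e j], so the
     decay at [m.+1] controls the whole period. *)
  have <- : sqnorm (z m.+1 j) = sqnorm (f j (u (m * q + 1)%N) (w m)).
    rewrite (f_next _ (zE m)) sqnormM [sqnorm (e j)](_ : _ = 1) ?mul1r//.
    by rewrite /sqnorm /= cos2Dsin2.
  apply: le_trans (hB m.+1) _.
  apply: (@le_trans _ _ (`|B| * m.+2%:R^-1 ^+ 2)).
    by rewrite ler_wpM2r ?sqr_ge0// ler_norm.
  by rewrite ler_wpM2l// ler_sqr ?nnegrE// lef_pV2 ?posrE// ler_nat.
- rewrite /boundary_condition u0 u1 /x0 /x1; case: (theta j == _) => //.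
  by rewrite divr1 oner_neq0.
Qed.
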